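(* Let $X$ be a CAT(0) Euclidean polygonal complex and let $x_1,x_2,x_3,x_4\in X$ be such that $\overline{x_1x_2}\cap\overline{x_3x_4}$ is a segment. Then $$\bigcap_{1\le i<j<k\le 4}\blacktriangle(x_i,x_j,x_k)=\overline{x_1x_2}\cap\overline{x_3x_4}.$$
   Context: A CAT(0) Euclidean polygonal complex is a 2-dimensional polygonal complex whose cells are convex Euclidean polygons, with its induced length metric, assumed CAT(0). $\overline{ab}$ denotes the unique geodesic between $a,b$; $\triangle(x,y,z)=\overline{xy}\cup\overline{yz}\cup\overline{zx}$. The full triangle $\blacktriangle(x,y,z)$ is the union of $\triangle(x,y,z)$ with the set of points $p\in X\setminus\triangle(x,y,z)$ for which $\triangle(x,y,z)$ is not null-homotopic in $X\setminus\{p\}$. *)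

(* Defs.v *)
From Stdlib Require Import Reals List.
Open Scope R_scope.

Definition R2 : Type := (R * R)%type.

Definition edist (u v : R2) : R :=
  sqrt ((fst u - fst v)^2 + (snd u - snd v)^2).

Definition interp (A B : R2) (t : R) : R2 :=
  (fst A + t * (fst B - fst A), snd A + t * (snd B - snd A)).

Definition in_hull (L : list R2) (p : R2) : Prop :=
  exists wl : list (R * R2),
    (forall w q, In (w, q) wl -> 0 <= w /\ In q L) /\
    fold_right (fun wq acc => fst wq + acc) 0 wl = 1 /\
    p = (fold_right (fun wq acc => fst wq * fst (snd wq) + acc) 0 wl,
         fold_right (fun wq acc => fst wq * snd (snd wq) + acc) 0 wl).

Definition convex_polygon (C : R2 -> Prop) : Prop :=
  exists L : list R2,
    (forall p, C p <-> in_hull L p) /\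
    exists c r, 0 < r /\ forall p, edist c p < r -> C p.

Definition face (C T : R2 -> Prop) : Prop :=
  (forall p, T p <-> C p) \/
  (exists a b c : R,
     (a <> 0 \/ b <> 0) /\
     (forall p, C p -> a * fst p + b * snd p <= c) /\
     (forall p, T p <-> (C p /\ a * fst p + b * snd p = c)) /\
     (exists p, T p)).

Definition isometry_onto (h : R2 -> R2) (T T' : R2 -> Prop) : Prop :=
  (forall u v, T u -> T v -> edist (h u) (h v) = edist u v) /\
  (forall u, T u -> T' (h u)) /\
  (forall v, T' v -> exists u, T u /\ h u = v).

Definition is_metric {X : Type} (d : X -> X -> R) : Prop :=
  (forall x y, 0 <= d x y) /\
  (forall x y, d x y = 0 <-> x = y) /\
  (forall x y, d x y = d y x) /\
  (forall x y z, d x z <= d x y + d y z).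

(** * Euclidean polygonal complexes (Bridson--Haefliger I.7.37, dim 2, kappa 0)

    [X] is the quotient of the disjoint union of the convex polygons
    [P i] (i : I) by the maps [f i : P i -> X]:
    - the [f i] are jointly surjective;
    - each [f i] is injective on [P i];
    - if [f i u = f j v] there is an isometry [h] from a face [T] of [P i]
      containing [u] onto a face [T'] of [P j] with [f j (h w) = f i w] on [T];
    - [d] is the induced (intrinsic / length) metric: the infimum of lengths
      of strings [x = x_0, ..., x_n = y] whose consecutive points lie in a
      common cell, measured in that cell. *)

Section Strings.
Context {X I : Type} (P : I -> R2 -> Prop) (f : I -> R2 -> X).

Fixpoint string_ok (x y : X) (l : list (I * R2 * R2)) : Prop :=
  match l with
  | nil => False
  | (i, u, v) :: l' =>
      P i u /\ P i v /\ f i u = x /\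
      match l' with
      | nil => f i v = y
      | _ :: _ => string_ok (f i v) y l'
      end
  end.

Definition string_length (l : list (I * R2 * R2)) : R :=
  fold_right (fun s acc => edist (snd (fst s)) (snd s) + acc) 0 l.

End Strings.

Definition euclidean_polygonal_complex (X : Type) (d : X -> X -> R)
    (I : Type) (P : I -> R2 -> Prop) (f : I -> R2 -> X) : Prop :=
  (forall i, convex_polygon (P i)) /\
  (forall x : X, exists i u, P i u /\ f i u = x) /\
  (forall i u v, P i u -> P i v -> f i u = f i v -> u = v) /\
  (forall i j u v, P i u -> P j v -> f i u = f j v ->
     exists (T T' : R2 -> Prop) (h : R2 -> R2),
       face (P i) T /\ face (P j) T' /\ T u /\ isometry_onto h T T' /\
       (forall w, T w -> f j (h w) = f i w)) /\
  is_metric d /\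
  (forall x y,
     (forall l, string_ok P f x y l -> d x y <= string_length l) /\
     (forall eps, 0 < eps ->
        exists l, string_ok P f x y l /\ string_length l < d x y + eps)).

Definition geodesic {X : Type} (d : X -> X -> R) (a b : X) (c : R -> X) : Prop :=
  c 0 = a /\ c (d a b) = b /\
  forall s t, 0 <= s <= d a b -> 0 <= t <= d a b -> d (c s) (c t) = Rabs (s - t).

Definition geodesic_space {X : Type} (d : X -> X -> R) : Prop :=
  forall a b, exists c, geodesic d a b c.

Definition side_point {X : Type} (d : X -> X -> R) (a b : X) (c : R -> X)
    (A B : R2) (x : X) (xb : R2) : Prop :=
  exists s, 0 <= s <= d a b /\ x = c s /\ xb = interp A B (s / d a b).

Definition CAT0 {X : Type} (d : X -> X -> R) : Prop :=
  geodesic_space d /\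
  forall (a b c : X) (c1 c2 c3 : R -> X) (A B C : R2),
    geodesic d a b c1 -> geodesic d b c c2 -> geodesic d c a c3 ->
    edist A B = d a b -> edist B C = d b c -> edist C A = d c a ->
    forall x xb y yb,
      (side_point d a b c1 A B x xb \/ side_point d b c c2 B C x xb \/
       side_point d c a c3 C A x xb) ->
      (side_point d a b c1 A B y yb \/ side_point d b c c2 B C y yb \/
       side_point d c a c3 C A y yb) ->
      d x y <= edist xb yb.

(** The geodesic segment [\overline{ab}] (the image of the geodesic from [a]
    to [b]; unique in a CAT(0) space). *)
Definition seg {X : Type} (d : X -> X -> R) (a b : X) (p : X) : Prop :=
  exists c, geodesic d a b c /\ exists s, 0 <= s <= d a b /\ p = c s.

Definition tri {X : Type} (d : X -> X -> R) (x y z : X) (p : X) : Prop :=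
  seg d x y p \/ seg d y z p \/ seg d z x p.

(** [\triangle(x,y,z)] as a closed loop [[0,3] -> X], built from geodesics
    [c1 : x -> y], [c2 : y -> z], [c3 : z -> x]. *)
Definition tri_loop {X : Type} (d : X -> X -> R) (x y z : X)
    (c1 c2 c3 : R -> X) (t : R) : X :=
  if Rle_dec t 1 then c1 (t * d x y)
  else if Rle_dec t 2 then c2 ((t - 1) * d y z)
  else c3 ((t - 2) * d z x).

Definition null_homotopic_avoiding {X : Type} (d : X -> X -> R)
    (g : R -> X) (p : X) : Prop :=
  exists H : R -> R -> X,
    (forall s t, 0 <= s <= 1 -> 0 <= t <= 3 ->
       forall eps, 0 < eps -> exists delta, 0 < delta /\
         forall s' t', 0 <= s' <= 1 -> 0 <= t' <= 3 ->
           Rabs (s - s') < delta -> Rabs (t - t') < delta ->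
           d (H s t) (H s' t') < eps) /\
    (forall s t, 0 <= s <= 1 -> 0 <= t <= 3 -> H s t <> p) /\
    (forall t, 0 <= t <= 3 -> H 0 t = g t) /\
    (forall t, 0 <= t <= 3 -> H 1 t = H 1 0) /\
    (forall s, 0 <= s <= 1 -> H s 0 = H s 3).

Definition full_tri {X : Type} (d : X -> X -> R) (x y z : X) (p : X) : Prop :=
  tri d x y z p \/
  (~ tri d x y z p /\
   forall c1 c2 c3, geodesic d x y c1 -> geodesic d y z c2 -> geodesic d z x c3 ->
     ~ null_homotopic_avoiding d (tri_loop d x y z c1 c2 c3) p).

(* Main.v *)
(** Write [\overline{x_1x_2} \cap \overline{x_3x_4} = \overline{ab}], with both
    geodesics running from [a] to [b]. Since [a <> b], the local geodesics
    [x_1 a b x_4] and [x_3 a b x_2] are geodesics. Contracting a triangle along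
    geodesics to a point [o] shows that the full triangle lies in the geodesic
    cone from [o] over its sides. With [o = a] or [o = b], each of the four full
    triangles lies in two of the segments [x_i a b x_j] together with [C_1], the
    cone from [a] over [\overline{x_1x_3}], or [C_2], the cone from [b] over
    [\overline{x_2x_4}]. At [a] the directions of [x_1] and [x_3] make an angle
    [pi] with [b], so a point of [\overline{x_1x_3}] makes an angle at least
    [pi/2] with [b]; hence [C_1] is strictly closer to [a] than to [b],
    symmetrically for [C_2], and [C_1], [C_2] are disjoint. *)

Require Import Defs.
From Stdlib Require Import Reals Lra Classical ClassicalEpsilon.
Open Scope R_scope.

(** * Betweenness in place of parametrised geodesics *)

Definition between {X : Type} (d : X -> X -> R) (x p y : X) : Prop :=
  d x p + d p y = d x y.

(** A single equation encoding that [a] and [b] lie in this order, possibly with coincidences, on a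
    geodesic from [x] to [y]. *)
Definition chain {X : Type} (d : X -> X -> R) (x a b y : X) : Prop :=
  d x y = d x a + d a b + d b y.

(** An outer bound for the full triangle that is free of homotopy. The apex [o] is arbitrary, so
    that [a] or [b] can be chosen for each triangle later. *)
Definition in_cones {X : Type} (d : X -> X -> R) (x y z p : X) : Prop :=
  forall o, exists q,
    (between d x q y \/ between d y q z \/ between d z q x) /\ between d o p q.

Section CAT0Geometry.
Context {X : Type} (d : X -> X -> R) (Hm : is_metric d) (Hcat : CAT0 d).

Lemma dist_ge0 x y : 0 <= d x y.
Proof. apply Hm. Qed.

Lemma dist_refl x : d x x = 0.
Proof. apply Hm; reflexivity. Qed.

Lemma dist_sym x y : d x y = d y x.
Proof. apply Hm. Qed.

Lemma dist_triangle x y z : d x z <= d x y + d y z.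
Proof. apply Hm. Qed.

Lemma dist_eq0 x y : d x y <= 0 -> x = y.
Proof. intros H; apply Hm; pose proof (dist_ge0 x y); lra. Qed.

Lemma between_sym x p y : between d x p y -> between d y p x.
Proof.
  unfold between; rewrite (dist_sym y p), (dist_sym p x), (dist_sym y x); lra.
Qed.

Lemma between_left x y : between d x x y.
Proof. unfold between; rewrite dist_refl; lra. Qed.

Lemma between_right x y : between d x y y.
Proof. unfold between; rewrite dist_refl; lra. Qed.

Lemma chain_sym x a b y : chain d x a b y -> chain d y b a x.
Proof.
  unfold chain.
  rewrite (dist_sym y x), (dist_sym y b), (dist_sym b a), (dist_sym a x); lra.
Qed.

Lemma geodesic_between a b c s :
  geodesic d a b c -> 0 <= s <= d a b ->
  d a (c s) = s /\ d (c s) b = d a b - s.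
Proof.
  intros (H0 & H1 & H2) Hs. split.
  - rewrite <- H0 at 1. rewrite H2 by lra.
    replace (0 - s) with (- s) by ring. rewrite Rabs_Ropp, Rabs_pos_eq; lra.
  - rewrite <- H1 at 1. rewrite H2 by lra.
    rewrite Rabs_left1; lra.
Qed.

(** Geodesics from [x] to [p] and from [p] to [y] are joined. For two points on different sides of
    [p], a shortcut would make the distance from [x] to [y] smaller than [d x p + d p y]. *)
Lemma geodesic_concat x p y : between d x p y ->
  exists c, geodesic d x y c /\ p = c (d x p).
Proof.
  unfold between; intros Hb.
  destruct (proj1 Hcat x p) as [c1 G1]. destruct (proj1 Hcat p y) as [c2 G2].
  pose proof (dist_ge0 x p) as P1. pose proof (dist_ge0 p y) as P2.
  set (c := fun s => if Rle_dec s (d x p) then c1 s else c2 (s - d x p)).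
  assert (Hle : forall s t, 0 <= s <= d x y -> 0 <= t <= d x y -> s <= t ->
            d (c s) (c t) = t - s).
  { intros s t Hs Ht Hst. unfold c.
    destruct (Rle_dec s (d x p)), (Rle_dec t (d x p)); try lra.
    - destruct G1 as (_ & _ & G). rewrite G by lra. rewrite Rabs_left1; lra.
    - destruct (geodesic_between _ _ _ s G1) as [A1 A2]; [lra|].
      destruct (geodesic_between _ _ _ (t - d x p) G2) as [B1 B2]; [lra|].
      pose proof (dist_triangle (c1 s) p (c2 (t - d x p))).
      pose proof (dist_triangle x (c1 s) y).
      pose proof (dist_triangle (c1 s) (c2 (t - d x p)) y). lra.
    - destruct G2 as (_ & _ & G). rewrite G by lra. rewrite Rabs_left1; lra. }
  exists c. split; [split; [|split]|].
  - unfold c. destruct (Rle_dec 0 (d x p)); [apply G1 | lra].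
  - unfold c. destruct (Rle_dec (d x y) (d x p)).
    + assert (p = y) by (apply dist_eq0; lra). subst y. apply G1.
    + replace (d x y - d x p) with (d p y) by lra. apply G2.
  - intros s t Hs Ht. destruct (Rle_dec s t).
    + rewrite Hle by lra. rewrite Rabs_left1; lra.
    + rewrite dist_sym, Hle by lra. rewrite Rabs_pos_eq; lra.
  - unfold c. destruct (Rle_dec (d x p) (d x p)); [|lra].
    symmetry; apply G1.
Qed.

Lemma seg_between x y p : seg d x y p <-> between d x p y.
Proof.
  split.
  - intros (c & G & s & Hs & ->).
    destruct (geodesic_between _ _ _ s G Hs). unfold between; lra.
  - intros H. destruct (geodesic_concat _ _ _ H) as (c & G & E).
    exists c. split; [exact G|]. exists (d x p). split; [|exact E].
    unfold between in H. pose proof (dist_ge0 x p). pose proof (dist_ge0 p y). lra.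
Qed.

Lemma tri_between x y z p : tri d x y z p <->
  between d x p y \/ between d y p z \/ between d z p x.
Proof. unfold tri; rewrite !seg_between; tauto. Qed.

(** * The CAT(0) comparison inequality *)

(** Apex of the planar triangle with base from (0,0) to (L,0): subtracting the two equations gives
    [e], and the triangle inequalities make the squared height [p^2 - e^2] nonnegative. *)
Lemma comparison_apex L p q : 0 < L -> 0 <= p -> 0 <= q ->
  L <= p + q -> p <= L + q -> q <= L + p ->
  exists e f, e^2 + f^2 = p^2 /\ (L - e)^2 + f^2 = q^2.
Proof.
  intros HL Hp Hq H1 H2 H3.
  pose (e := (L^2 + p^2 - q^2) / (2 * L)).
  assert (He : 2 * L * e = L^2 + p^2 - q^2) by (unfold e; field; lra).
  assert (Hf : 0 <= p^2 - e^2).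
  { assert (0 <= (p - e) * (p + e)); [|nra].
    assert (0 <= 2 * L * (p - e)) by nra.
    assert (0 <= 2 * L * (p + e)) by nra.
    apply Rmult_le_pos; nra. }
  exists e, (sqrt (p^2 - e^2)). rewrite pow2_sqrt by exact Hf. split; nra.
Qed.

(* Stewart's identity in the comparison triangle, with denominators cleared. *)
Lemma stewart x m y z : between d x m y ->
  d x y * (d m z)^2 + d x y * d x m * d m y
    <= d m y * (d x z)^2 + d x m * (d y z)^2.
Proof.
  intros Hb. pose proof Hb as Hb'. unfold between in Hb'.
  pose proof (dist_ge0 x m) as P1. pose proof (dist_ge0 m y) as P2.
  pose proof (dist_ge0 x z) as P3. pose proof (dist_ge0 y z) as P4.
  pose proof (dist_ge0 m z) as P5.
  destruct (Req_dec (d x y) 0) as [E|E].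
  { replace (d x m) with 0 by lra. replace (d m y) with 0 by lra. rewrite E; lra. }
  destruct (comparison_apex (d x y) (d x z) (d y z)) as (e & f & E1 & E2);
    [lra | lra | lra | | | |].
  { rewrite (dist_sym y z); apply dist_triangle. }
  { apply dist_triangle. }
  { rewrite (dist_sym x y); apply dist_triangle. }
  destruct (geodesic_concat _ _ _ Hb) as (c1 & G1 & M1).
  destruct (proj1 Hcat y z) as [c2 G2]. destruct (proj1 Hcat z x) as [c3 G3].
  (* Comparison triangle: [x] at the origin, [y] at [(d x y, 0)], [z] at [(e, f)]; hence [m]
     corresponds to [(d x m, 0)]. *)
  assert (K : d m z <= edist (d x m, 0) (e, f)).
  { apply (proj2 Hcat x y z c1 c2 c3 (0, 0) (d x y, 0) (e, f) G1 G2 G3).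
    - unfold edist; simpl fst; simpl snd.
      replace ((0 - d x y)^2 + (0 - 0)^2) with ((d x y)^2) by ring.
      apply sqrt_pow2; lra.
    - unfold edist; simpl fst; simpl snd.
      replace ((d x y - e)^2 + (0 - f)^2) with ((d y z)^2) by (rewrite <- E2; ring).
      apply sqrt_pow2; lra.
    - unfold edist; simpl fst; simpl snd. rewrite (dist_sym z x).
      replace ((e - 0)^2 + (f - 0)^2) with ((d x z)^2) by (rewrite <- E1; ring).
      apply sqrt_pow2; lra.
    - left. exists (d x m). split; [lra|]. split; [exact M1|].
      unfold interp; simpl. f_equal; field; exact E.
    (* [z] is the start of the third side; parameter 0 gives quotient 0 even if [d z x = 0]. *)
    - right; right. exists 0. split; [split; [lra | apply dist_ge0]|].
      split; [symmetry; apply G3|].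
      unfold interp, Rdiv; simpl. f_equal; ring. }
  assert (K2 : (d m z)^2 <= (d x m - e)^2 + f^2).
  { unfold edist in K; simpl fst in K; simpl snd in K.
    replace ((0 - f)^2) with (f^2) in K by ring.
    rewrite <- (pow2_sqrt ((d x m - e)^2 + f^2))
      by (apply Rplus_le_le_0_compat; apply pow2_ge_0).
    apply pow_incr; lra. }
  replace (d m y) with (d x y - d x m) by lra.
  assert (d x y * (d m z)^2 <= d x y * ((d x m - e)^2 + f^2))
    by (apply Rmult_le_compat_l; lra).
  nra.
Qed.

(** * Order and convexity along a geodesic *)

(** Stewart's inequality for [p] on the side [x y], seen from [q]: since [q] has the same distances
    to [x] and [y] as [p], everything cancels except [d x y * (d p q)^2 <= 0]. *)
Lemma between_unique x y p q :
  between d x p y -> between d x q y -> d x p = d x q -> p = q.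
Proof.
  intros Hp Hq E. pose proof (stewart x p y q Hp) as S.
  unfold between in Hp, Hq. rewrite (dist_sym y q), <- E in S.
  replace (d q y) with (d p y) in S by lra.
  pose proof (dist_ge0 p q). pose proof (dist_ge0 x p). pose proof (dist_ge0 p y).
  apply dist_eq0.
  destruct (Req_dec (d x y) 0) as [E0|E0].
  - pose proof (dist_triangle p x q). rewrite (dist_sym p x) in *. lra.
  - assert (D : d x y * (d p q)^2 <= d x y * 0) by nra.
    apply Rmult_le_reg_l in D; [nra | lra].
Qed.

(** By uniqueness, a geodesic through [p] also passes through [q], so both are compared on one
    parametrisation. *)
Lemma between_dist x y p q :
  between d x p y -> between d x q y -> d p q = Rabs (d x p - d x q).
Proof.
  intros Hp Hq.
  destruct (geodesic_concat _ _ _ Hp) as (c & G & E).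
  assert (Bq : 0 <= d x q <= d x y).
  { unfold between in Hq. pose proof (dist_ge0 x q). pose proof (dist_ge0 q y). lra. }
  assert (Bp : 0 <= d x p <= d x y).
  { unfold between in Hp. pose proof (dist_ge0 x p). pose proof (dist_ge0 p y). lra. }
  destruct (geodesic_between _ _ _ _ G Bq) as [F1 F2].
  assert (Eq : q = c (d x q)).
  { apply (between_unique x y); [exact Hq | unfold between; lra | lra]. }
  rewrite E at 1. rewrite Eq at 1. apply G; assumption.
Qed.

Lemma between_convex x y p q r :
  between d x p y -> between d x q y -> between d p r q -> between d x r y.
Proof.
  intros Hp Hq Hr. pose proof (between_dist x y p q Hp Hq) as D.
  unfold between in *.
  pose proof (dist_triangle x p r). pose proof (dist_triangle r q y).
  pose proof (dist_triangle x q r). pose proof (dist_triangle r p y).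
  pose proof (dist_triangle x r y).
  rewrite (dist_sym r p), (dist_sym q r) in *.
  revert D; unfold Rabs; destruct (Rcase_abs _); lra.
Qed.

Lemma between_chain x y a b :
  between d x a y -> between d x b y -> chain d x a b y \/ chain d x b a y.
Proof.
  intros Ha Hb. pose proof (between_dist x y a b Ha Hb) as D.
  unfold between, chain in *. rewrite (dist_sym b a).
  revert D; unfold Rabs; destruct (Rcase_abs _); intros; [left|right]; lra.
Qed.

Lemma chain_between_left x a b y : chain d x a b y -> between d x a b.
Proof.
  unfold chain, between. intros.
  pose proof (dist_triangle x b y). pose proof (dist_triangle x a b). lra.
Qed.

Lemma chain_between_first x a b y : chain d x a b y -> between d x a y.
Proof.
  unfold chain, between. intros.
  pose proof (dist_triangle a b y). pose proof (dist_triangle x a y). lra.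
Qed.

Lemma chain_between_right x a b y : chain d x a b y -> between d a b y.
Proof. intros H. apply between_sym, chain_between_left with x, chain_sym, H. Qed.

Lemma chain_between_second x a b y : chain d x a b y -> between d x b y.
Proof. intros H. apply between_sym, chain_between_first with a, chain_sym, H. Qed.

Lemma chain_split x a b y p : chain d x a b y -> between d x p y ->
  between d x p a \/ between d a p b \/ between d b p y.
Proof.
  intros C Hp.
  pose proof (chain_between_first _ _ _ _ C) as Ha.
  pose proof (chain_between_second _ _ _ _ C) as Hb.
  pose proof (between_dist x y p a Hp Ha) as D1.
  pose proof (between_dist x y p b Hp Hb) as D2.
  unfold between, chain in *. rewrite (dist_sym a p), (dist_sym b p).
  pose proof (dist_ge0 a b).
  revert D1 D2; unfold Rabs; destruct (Rcase_abs _), (Rcase_abs _); intros; lra.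
Qed.

(* A local geodesic made of two geodesics overlapping in [a b] is a geodesic. *)
Lemma chain_of_overlap x a b y : a <> b ->
  between d x a b -> between d a b y -> chain d x a b y.
Proof.
  intros N H1 H2. pose proof (stewart x a b y H1) as S.
  unfold between, chain in *.
  assert (V : 0 < d a b).
  { destruct (Rlt_le_dec 0 (d a b)) as [h|h]; [exact h|].
    elim N; apply dist_eq0, h. }
  pose proof (dist_ge0 x a). pose proof (dist_ge0 b y). pose proof (dist_ge0 x y).
  (* With u, v, w for [d x a], [d a b], [d b y], Stewart's inequality reduces to v(u+v+w)^2 <= v
     d(x,y)^2, and v > 0 can be cancelled. *)
  rewrite <- H1, <- H2 in S.
  assert (d a b * (d x a + d a b + d b y)^2 <= d a b * (d x y)^2) by nra.
  assert ((d x a + d a b + d b y)^2 <= (d x y)^2)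
    by (apply Rmult_le_reg_l with (d a b); assumption).
  pose proof (dist_triangle x a y). pose proof (dist_triangle a b y).
  nra.
Qed.

(** * Separation of the cones at the two ends of the overlap *)

(** The last hypothesis says that the comparison angle at [a] between [x] and [y] is at most a right
    angle. Stewart's inequality then gives [(d y a)^2 + (d a b)^2 <= (d y b)^2], as for an angle of
    at least pi/2 towards [b]. *)
Lemma obtuse_dist x a b y : 0 < d x a -> 0 < d a b -> between d x a b ->
  (d x y)^2 <= (d x a)^2 + (d y a)^2 -> d y a < d y b.
Proof.
  intros Hx V H K. pose proof (stewart x a b y H) as S. unfold between in H.
  rewrite <- H in S. rewrite (dist_sym a y), (dist_sym b y) in S.
  pose proof (dist_ge0 y a). pose proof (dist_ge0 y b).
  assert (d x a * ((d y a)^2 + (d a b)^2) <= d x a * (d y b)^2) by nra.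
  assert ((d y a)^2 + (d a b)^2 <= (d y b)^2)
    by (apply Rmult_le_reg_l with (d x a); assumption).
  nra.
Qed.

(** The path from [x] through [a] to [x'] is at least as long as the one through [y], so [y] is no
    farther than [a] from [x] or from [x']. [obtuse_dist] applies with that endpoint, unless it
    equals [a]; coincidences with [a] are treated first. *)
Lemma base_closer x x' a b y : 0 < d a b -> between d x a b -> between d x' a b ->
  between d x y x' -> d y a < d y b.
Proof.
  intros V H H' Hy. unfold between in Hy.
  pose proof (dist_ge0 x y). pose proof (dist_ge0 y x').
  pose proof (dist_ge0 x a). pose proof (dist_ge0 x' a). pose proof (dist_ge0 y a).
  pose proof (dist_triangle x a x') as T.
  pose proof (dist_triangle x' a x) as T'.
  rewrite (dist_sym a x') in T. rewrite (dist_sym y x') in *.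
  destruct (Req_dec (d x a) 0) as [E|E], (Req_dec (d x' a) 0) as [E'|E'].
  - assert (y = a) as ->.
    { apply eq_trans with x; [symmetry|]; apply dist_eq0; lra. }
    rewrite dist_refl; exact V.
  - assert (x = a) by (apply dist_eq0; lra). subst x.
    apply (obtuse_dist x' a b y); try lra; try assumption. nra.
  - assert (x' = a) by (apply dist_eq0; lra). subst x'.
    apply (obtuse_dist x a b y); try lra; try assumption. nra.
  - destruct (Rle_dec ((d x y)^2) ((d x a)^2 + (d y a)^2)).
    + apply (obtuse_dist x a b y); try lra; assumption.
    + apply (obtuse_dist x' a b y); try lra; try assumption.
      assert (d x a < d x y) by nra. nra.
Qed.

(** Going from [y] to [p] shortens the distance to [a] by the full length [d y p], and the distance
    to [b] by at most that much. *)
Lemma cone_closer x x' a b y p : 0 < d a b ->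
  between d x a b -> between d x' a b -> between d x y x' ->
  between d a p y -> d p a < d p b.
Proof.
  intros V H H' Hy Hp. pose proof (base_closer x x' a b y V H H' Hy).
  unfold between in Hp. pose proof (dist_triangle y p b).
  rewrite (dist_sym a p), (dist_sym a y), (dist_sym p y) in *. lra.
Qed.

(** * Contracting a triangle along geodesics *)

(** [r] and [r'] are [q] and [q'] moved by the fraction [s] towards [o]. Stewart's inequality on
    [q o] seen from [q'], then on [q' o] seen from [r], gives the factor [1 - s], as the terms in
    [P] and [Q] cancel. *)
Lemma contraction_lipschitz o q q' r r' s : 0 <= s <= 1 ->
  d q r = s * d q o -> d r o = (1 - s) * d q o ->
  d q' r' = s * d q' o -> d r' o = (1 - s) * d q' o ->
  d r r' <= d q q'.
Proof.
  intros Hs A1 A2 B1 B2.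
  pose proof (dist_ge0 q o). pose proof (dist_ge0 q' o).
  pose proof (dist_ge0 q q'). pose proof (dist_ge0 r r').
  destruct (Req_dec (d q o) 0) as [E|E].
  { assert (q = o) by (apply dist_eq0; lra). subst q.
    assert (r = o) as -> by (apply dist_eq0; rewrite A2, E; lra).
    rewrite (dist_sym o r'), (dist_sym o q'). nra. }
  destruct (Req_dec (d q' o) 0) as [E'|E'].
  { assert (q' = o) by (apply dist_eq0; lra). subst q'.
    assert (r' = o) as -> by (apply dist_eq0; rewrite B2, E'; lra). nra. }
  pose proof (stewart q r o q') as S1. pose proof (stewart q' r' o r) as S2.
  unfold between in *. specialize (S1 ltac:(lra)). specialize (S2 ltac:(lra)).
  rewrite A1, A2 in S1. rewrite B1, B2 in S2.
  rewrite (dist_sym o r), A2, (dist_sym r' r), (dist_sym q' r) in S2.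
  rewrite (dist_sym o q') in S1.
  set (P := d q o) in *. set (Q := d q' o) in *.
  assert (T1 : (d r q')^2 <= (1-s) * (d q q')^2 + s * Q^2 - s * (1-s) * P^2).
  { apply Rmult_le_reg_l with P; [lra|]. nra. }
  assert (T2 : (d r r')^2 <= (1-s) * (d r q')^2 + s * ((1-s) * P)^2 - s * (1-s) * Q^2).
  { apply Rmult_le_reg_l with Q; [lra|]. nra. }
  assert (T3 : (d r r')^2 <= (1-s)^2 * (d q q')^2).
  { assert ((1-s) * (d r q')^2 <=
      (1-s) * ((1-s) * (d q q')^2 + s * Q^2 - s * (1-s) * P^2))
      by (apply Rmult_le_compat_l; lra).
    nra. }
  assert ((1-s)^2 <= 1) by nra.
  assert ((d r r')^2 <= (d q q')^2) by (pose proof (pow2_ge_0 (d q q')); nra).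
  nra.
Qed.

Lemma geodesic_lipschitz a b c K s t : geodesic d a b c -> d a b <= K ->
  0 <= s -> s <= t -> t <= 1 -> d (c (s * d a b)) (c (t * d a b)) <= K * (t - s).
Proof.
  intros G HK H1 H2 H3. pose proof (dist_ge0 a b).
  destruct G as (_ & _ & G). rewrite G by (split; nra).
  rewrite Rabs_left1 by nra. nra.
Qed.

Lemma tri_loop_lipschitz x y z c1 c2 c3 :
  geodesic d x y c1 -> geodesic d y z c2 -> geodesic d z x c3 ->
  exists K, 0 <= K /\ forall t t', 0 <= t <= 3 -> 0 <= t' <= 3 ->
    d (tri_loop d x y z c1 c2 c3 t) (tri_loop d x y z c1 c2 c3 t')
      <= K * Rabs (t - t').
Proof.
  intros G1 G2 G3.
  pose proof (dist_ge0 x y). pose proof (dist_ge0 y z). pose proof (dist_ge0 z x).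
  (* The perimeter bounds the speed on every side. *)
  set (K := d x y + d y z + d z x). exists K. split; [unfold K; lra|].
  set (g := tri_loop d x y z c1 c2 c3).
  assert (L1 : forall s t, 0 <= s -> s <= t -> t <= 1 -> d (g s) (g t) <= K * (t - s)).
  { intros s t A B C. unfold g, tri_loop.
    destruct (Rle_dec s 1), (Rle_dec t 1); try lra.
    apply geodesic_lipschitz; try assumption. unfold K; lra. }
  (* At the breakpoints 1 and 2 [tri_loop] uses the earlier side; the next side has the same value
     there, so its formula holds on the closed interval. *)
  assert (g1 : g 1 = c2 ((1 - 1) * d y z)).
  { unfold g, tri_loop. destruct (Rle_dec 1 1); [|lra].
    rewrite Rmult_1_l. replace ((1 - 1) * d y z) with 0 by ring.
    transitivity y; [apply G1 | symmetry; apply G2]. }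
  assert (g2 : g 2 = c3 ((2 - 2) * d z x)).
  { unfold g, tri_loop. destruct (Rle_dec 2 1); [lra|].
    destruct (Rle_dec 2 2); [|lra].
    replace ((2 - 1) * d y z) with (d y z) by ring.
    replace ((2 - 2) * d z x) with 0 by ring.
    transitivity z; [apply G2 | symmetry; apply G3]. }
  assert (e2 : forall t, 1 <= t <= 2 -> g t = c2 ((t - 1) * d y z)).
  { intros t Ht. destruct (Req_dec t 1) as [->|]; [exact g1|].
    unfold g, tri_loop. destruct (Rle_dec t 1); [lra|].
    destruct (Rle_dec t 2); [reflexivity|lra]. }
  assert (e3 : forall t, 2 <= t <= 3 -> g t = c3 ((t - 2) * d z x)).
  { intros t Ht. destruct (Req_dec t 2) as [->|]; [exact g2|].
    unfold g, tri_loop. destruct (Rle_dec t 1); [lra|].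
    destruct (Rle_dec t 2); [lra|reflexivity]. }
  assert (L2 : forall s t, 1 <= s -> s <= t -> t <= 2 -> d (g s) (g t) <= K * (t - s)).
  { intros s t A B C. rewrite !e2 by lra.
    replace (t - s) with ((t - 1) - (s - 1)) by ring.
    apply geodesic_lipschitz; try assumption; try lra. unfold K; lra. }
  assert (L3 : forall s t, 2 <= s -> s <= t -> t <= 3 -> d (g s) (g t) <= K * (t - s)).
  { intros s t A B C. rewrite !e3 by lra.
    replace (t - s) with ((t - 2) - (s - 2)) by ring.
    apply geodesic_lipschitz; try assumption; try lra. unfold K; lra. }
  assert (L23 : forall s t, 1 <= s -> s <= t -> t <= 3 -> d (g s) (g t) <= K * (t - s)).
  { intros s t A B C. destruct (Rle_dec t 2); [apply L2; lra|].
    destruct (Rle_dec 2 s); [apply L3; lra|].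
    pose proof (dist_triangle (g s) (g 2) (g t)).
    pose proof (L2 s 2 ltac:(lra) ltac:(lra) ltac:(lra)).
    pose proof (L3 2 t ltac:(lra) ltac:(lra) ltac:(lra)). lra. }
  assert (L : forall s t, 0 <= s -> s <= t -> t <= 3 -> d (g s) (g t) <= K * (t - s)).
  { intros s t A B C. destruct (Rle_dec t 1); [apply L1; lra|].
    destruct (Rle_dec 1 s); [apply L23; lra|].
    pose proof (dist_triangle (g s) (g 1) (g t)).
    pose proof (L1 s 1 ltac:(lra) ltac:(lra) ltac:(lra)).
    pose proof (L23 1 t ltac:(lra) ltac:(lra) ltac:(lra)). lra. }
  intros t t' Ht Ht'. destruct (Rle_dec t t').
  - rewrite Rabs_left1 by lra. pose proof (L t t' ltac:(lra) ltac:(lra) ltac:(lra)). lra.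
  - rewrite Rabs_pos_eq by lra. rewrite dist_sym. apply L; lra.
Qed.

Lemma tri_loop_tri x y z c1 c2 c3 t :
  geodesic d x y c1 -> geodesic d y z c2 -> geodesic d z x c3 -> 0 <= t <= 3 ->
  tri d x y z (tri_loop d x y z c1 c2 c3 t).
Proof.
  intros G1 G2 G3 Ht.
  pose proof (dist_ge0 x y). pose proof (dist_ge0 y z). pose proof (dist_ge0 z x).
  unfold tri_loop.
  destruct (Rle_dec t 1); [|destruct (Rle_dec t 2)]; [left | right; left | right; right];
    eexists; (split; [eassumption|]); eexists; (split; [|reflexivity]); nra.
Qed.

(** The homotopy moves each [g t] along a geodesic to [o]; it meets [p] only if [p] lies between [o]
    and some [g t]. *)
Lemma loop_contraction (g : R -> X) K o p : 0 <= K ->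
  (forall t t', 0 <= t <= 3 -> 0 <= t' <= 3 -> d (g t) (g t') <= K * Rabs (t - t')) ->
  g 0 = g 3 ->
  (forall t, 0 <= t <= 3 -> ~ between d o p (g t)) ->
  null_homotopic_avoiding d g p.
Proof.
  intros HK Lg Eg Hp.
  destruct (choice (fun q c => geodesic d q o c)) as [m Gm].
  { intros q; apply (proj1 Hcat). }
  assert (M : forall q s, 0 <= s <= 1 ->
    d q (m q (s * d q o)) = s * d q o /\ d (m q (s * d q o)) o = (1 - s) * d q o).
  { intros q s Hs. pose proof (dist_ge0 q o).
    destruct (geodesic_between _ _ _ (s * d q o) (Gm q)); [split; nra|].
    split; [assumption | lra]. }
  exists (fun s t => m (g t) (s * d (g t) o)).
  split; [|split; [|split; [|split]]].
  - intros s t Hs Ht eps He.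
    pose proof (dist_ge0 (g t) o) as P.
    (* A change of [s] costs at most the factor [d (g t) o], a change of [t] at most [K]; the extra
       1 makes [N] positive and the final bound strict. *)
    set (N := d (g t) o + K + 1).
    exists (eps / N). split; [apply Rdiv_lt_0_compat; unfold N; lra|].
    intros s' t' Hs' Ht' As At.
    pose proof (dist_triangle (m (g t) (s * d (g t) o)) (m (g t) (s' * d (g t) o))
      (m (g t') (s' * d (g t') o))) as T.
    assert (T1 : d (m (g t) (s * d (g t) o)) (m (g t) (s' * d (g t) o))
                 = Rabs (s - s') * d (g t) o).
    { destruct (Gm (g t)) as (_ & _ & G). rewrite G by (split; nra).
      rewrite <- Rmult_minus_distr_r, Rabs_mult, (Rabs_pos_eq (d (g t) o)) by exact P.
      reflexivity. }
    assert (T2 : d (m (g t) (s' * d (g t) o)) (m (g t') (s' * d (g t') o)) <= d (g t) (g t')).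
    { apply contraction_lipschitz with o s'; try apply M; lra. }
    pose proof (Lg t t' Ht Ht').
    assert (E : eps = d (g t) o * (eps / N) + K * (eps / N) + eps / N)
      by (unfold N; field; lra).
    assert (0 < eps / N) by (apply Rdiv_lt_0_compat; unfold N; lra).
    assert (Rabs (s - s') * d (g t) o <= d (g t) o * (eps / N)) by nra.
    assert (K * Rabs (t - t') <= K * (eps / N)) by nra.
    lra.
  - intros s t Hs Ht E. apply (Hp t Ht). destruct (M (g t) s Hs) as [M1 M2].
    rewrite E in M1, M2. apply between_sym. unfold between. lra.
  - intros t Ht. destruct (M (g t) 0 ltac:(lra)) as [M1 M2].
    symmetry. apply dist_eq0. lra.
  - intros t Ht. transitivity o; [|symmetry]; apply dist_eq0.
    + destruct (M (g t) 1 ltac:(lra)); lra.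
    + destruct (M (g 0) 1 ltac:(lra)); lra.
  - intros s Hs. rewrite Eg. reflexivity.
Qed.

(** A point of the triangle is its own [q]. For any other point outside the cone from [o],
    contracting the triangle to [o] would be a null-homotopy avoiding it. *)
Lemma full_tri_in_cones x y z p : full_tri d x y z p -> in_cones d x y z p.
Proof.
  intros [T|[_ T]] o.
  { exists p. split; [apply tri_between, T | apply between_right]. }
  apply NNPP. intros N.
  destruct (proj1 Hcat x y) as [c1 G1]. destruct (proj1 Hcat y z) as [c2 G2].
  destruct (proj1 Hcat z x) as [c3 G3].
  apply (T c1 c2 c3 G1 G2 G3).
  destruct (tri_loop_lipschitz _ _ _ _ _ _ G1 G2 G3) as (K & HK & L).
  apply (loop_contraction _ K o); [exact HK | exact L | |].
  - unfold tri_loop. destruct (Rle_dec 0 1); [|lra].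
    destruct (Rle_dec 3 1); [lra|]. destruct (Rle_dec 3 2); [lra|].
    replace (0 * d x y) with 0 by ring. replace ((3 - 2) * d z x) with (d z x) by ring.
    transitivity x; [apply G1 | symmetry; apply G3].
  - intros t Ht B. apply N. eexists. split; [|exact B].
    apply tri_between, tri_loop_tri; assumption.
Qed.

(** * Intersecting the four cones *)

Lemma in_cones_swap x y z p : in_cones d x y z p -> in_cones d x z y p.
Proof.
  intros H o. destruct (H o) as (q & T & B). exists q. split; [|exact B].
  destruct T as [T|[T|T]]; apply between_sym in T; tauto.
Qed.

Lemma cones_meet_in_overlap x1 x2 x3 x4 a b p : a <> b ->
  chain d x1 a b x2 -> chain d x3 a b x4 ->
  in_cones d x1 x2 x3 p -> in_cones d x1 x2 x4 p ->
  in_cones d x1 x3 x4 p -> in_cones d x2 x3 x4 p ->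
  between d x1 p x2 /\ between d x3 p x4.
Proof.
  intros N C12 C34 K123 K124 K134 K234.
  assert (V : 0 < d a b).
  { destruct (Rlt_le_dec 0 (d a b)) as [h|h]; [exact h|].
    elim N; apply dist_eq0, h. }
  assert (C14 : chain d x1 a b x4)
    by (apply chain_of_overlap; [exact N
        | apply chain_between_left with x2, C12 | apply chain_between_right with x3, C34]).
  assert (C32 : chain d x3 a b x2)
    by (apply chain_of_overlap; [exact N
        | apply chain_between_left with x4, C34 | apply chain_between_right with x1, C12]).
  pose (Cone := fun o u v => exists y, between d u y v /\ between d o p y).
  assert (Cd : Cone a x1 x3 -> Cone b x2 x4 -> False).
  { intros (y & Y1 & Y2) (z & Z1 & Z2).
    assert (d p a < d p b).
    { apply (cone_closer x1 x3 a b y); try assumption.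
      - apply chain_between_left with x2, C12.
      - apply chain_between_left with x4, C34. }
    assert (d p b < d p a).
    { apply (cone_closer x2 x4 b a z); try assumption.
      - rewrite dist_sym; exact V.
      - apply chain_between_left with x1, chain_sym, C12.
      - apply chain_between_left with x3, chain_sym, C34. }
    lra. }
  (* A side through the apex contains its own cone, by convexity; only a side missing the apex
     contributes a genuine cone. *)
  assert (Ca : forall x y, chain d x a b y -> forall q,
             between d x q y -> between d a p q -> between d x p y).
  { intros x y C q. apply between_convex, (chain_between_first _ _ _ _ C). }
  assert (Cb : forall x y, chain d x a b y -> forall q,
             between d x q y -> between d b p q -> between d x p y).
  { intros x y C q. apply between_convex, (chain_between_second _ _ _ _ C). }
  (* The apex is [a] for the triangles with both [x1] and [x3], and [b] for those with both [x2] and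
     [x4]: the two remaining sides then pass through it. *)
  assert (Q123 : between d x1 p x2 \/ between d x3 p x2 \/ Cone a x1 x3).
  { destruct (K123 a) as (q & [T|[T|T]] & B).
    - left; eapply Ca; eassumption.
    - right; left; apply between_sym in T; eapply Ca; eassumption.
    - right; right; exists q; split; [apply between_sym, T | exact B]. }
  assert (Q134 : between d x3 p x4 \/ between d x1 p x4 \/ Cone a x1 x3).
  { destruct (K134 a) as (q & [T|[T|T]] & B).
    - right; right; exists q; split; assumption.
    - left; eapply Ca; eassumption.
    - right; left; apply between_sym in T; eapply Ca; eassumption. }
  assert (Q124 : between d x1 p x2 \/ between d x1 p x4 \/ Cone b x2 x4).
  { destruct (K124 b) as (q & [T|[T|T]] & B).
    - left; eapply Cb; eassumption.
    - right; right; exists q; split; assumption.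
    - right; left; apply between_sym in T; eapply Cb; eassumption. }
  assert (Q234 : between d x3 p x2 \/ between d x3 p x4 \/ Cone b x2 x4).
  { destruct (K234 b) as (q & [T|[T|T]] & B).
    - left; apply between_sym in T; eapply Cb; eassumption.
    - right; left; eapply Cb; eassumption.
    - right; right; exists q; split; [apply between_sym, T | exact B]. }
  assert (S12 := chain_split _ _ _ _ p C12). assert (S34 := chain_split _ _ _ _ p C34).
  assert (S14 := chain_split _ _ _ _ p C14). assert (S32 := chain_split _ _ _ _ p C32).
  (* The parts of the four segments outside [a b] lie in the cones, with an endpoint [xi] as the
     base point. *)
  assert (A1 : between d x1 p a -> Cone a x1 x3).
  { exists x1; split; [apply between_left | apply between_sym; assumption]. }
  assert (A3 : between d x3 p a -> Cone a x1 x3).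
  { exists x3; split; [apply between_right | apply between_sym; assumption]. }
  assert (A2 : between d b p x2 -> Cone b x2 x4).
  { exists x2; split; [apply between_left | assumption]. }
  assert (A4 : between d b p x4 -> Cone b x2 x4).
  { exists x4; split; [apply between_right | assumption]. }
  assert (I : forall x y, chain d x a b y ->
    between d x p a \/ between d a p b \/ between d b p y -> between d x p y).
  { intros x y C [B|[B|B]].
    - exact (between_convex _ _ _ _ _ (between_left x y)
        (chain_between_first _ _ _ _ C) B).
    - exact (between_convex _ _ _ _ _ (chain_between_first _ _ _ _ C)
        (chain_between_second _ _ _ _ C) B).
    - exact (between_convex _ _ _ _ _ (chain_between_second _ _ _ _ C)
        (between_right x y) B). }
  (* In the cone at [a], [p] cannot lie beyond [b], and symmetrically; outside both cones it must
     lie on [a b]. The rest is propositional. *)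
  destruct (classic (Cone a x1 x3)) as [Ya|Na].
  - assert (Nb : ~ Cone b x2 x4) by (intros Yb; exact (Cd Ya Yb)).
    assert (L1 : between d x1 p a \/ between d a p b)
      by (clear - Nb Q124 S12 S14 A2 A4; tauto).
    assert (L3 : between d x3 p a \/ between d a p b)
      by (clear - Nb Q234 S34 S32 A2 A4; tauto).
    split; apply I; [exact C12 | clear - L1; tauto | exact C34 | clear - L3; tauto].
  - destruct (classic (Cone b x2 x4)) as [Yb|Nb].
    + assert (L2 : between d a p b \/ between d b p x2)
        by (clear - Na Q123 S12 S32 A1 A3; tauto).
      assert (L4 : between d a p b \/ between d b p x4)
        by (clear - Na Q134 S34 S14 A1 A3; tauto).
      split; apply I; [exact C12 | clear - L2; tauto | exact C34 | clear - L4; tauto].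
    + assert (M : between d a p b)
        by (clear - Na Nb Q123 S12 S32 A1 A2 A3; tauto).
      split; apply I; [exact C12 | clear - M; tauto | exact C34 | clear - M; tauto].
Qed.

End CAT0Geometry.

Theorem theorem8p1 (X : Type) (d : X -> X -> R)
    (I : Type) (P : I -> R2 -> Prop) (f : I -> R2 -> X)
    (Hcx : euclidean_polygonal_complex X d I P f) (Hcat : CAT0 d)
    (x1 x2 x3 x4 : X)
    (Hseg : exists a b : X, a <> b /\
       forall p, (seg d x1 x2 p /\ seg d x3 x4 p) <-> seg d a b p) :
  forall p : X,
    (full_tri d x1 x2 x3 p /\ full_tri d x1 x2 x4 p /\
     full_tri d x1 x3 x4 p /\ full_tri d x2 x3 x4 p) <->
    (seg d x1 x2 p /\ seg d x3 x4 p).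
Proof.
  assert (Hm : is_metric d) by apply Hcx.
  intros p. rewrite !(seg_between d Hm Hcat). split.
  - intros (F123 & F124 & F134 & F234).
    apply (full_tri_in_cones d Hm Hcat) in F123, F124, F134, F234.
    destruct Hseg as (a & b & N & E).
    assert (Ea := proj2 (E a)). assert (Eb := proj2 (E b)).
    rewrite !(seg_between d Hm Hcat) in Ea, Eb.
    destruct (Ea (between_left d Hm _ _)) as [a12 a34].
    destruct (Eb (between_right d Hm _ _)) as [b12 b34].
    assert (N' : b <> a) by congruence.
    pose proof (in_cones_swap d Hm _ _ _ _ F134) as F143.
    pose proof (in_cones_swap d Hm _ _ _ _ F234) as F243.
    (* If the two segments traverse [a] and [b] in opposite orders, [x3] and [x4] are exchanged; if
       [x1 x2] meets [b] first, [a] and [b] are exchanged. *)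
    destruct (between_chain d Hm Hcat _ _ _ _ a12 b12) as [C|C],
      (between_chain d Hm Hcat _ _ _ _ a34 b34) as [C'|C'].
    + apply (cones_meet_in_overlap d Hm Hcat x1 x2 x3 x4 a b); assumption.
    + apply (chain_sym d Hm) in C'.
      destruct (cones_meet_in_overlap d Hm Hcat x1 x2 x4 x3 a b p) as [B B'];
        try assumption.
      split; [exact B | apply (between_sym d Hm), B'].
    + apply (chain_sym d Hm) in C'.
      destruct (cones_meet_in_overlap d Hm Hcat x1 x2 x4 x3 b a p) as [B B'];
        try assumption.
      split; [exact B | apply (between_sym d Hm), B'].
    + apply (cones_meet_in_overlap d Hm Hcat x1 x2 x3 x4 b a); assumption.
  - intros [B12 B34].
    (* Each of the four triangles has [x1 x2] or [x3 x4] as a side. *)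
    repeat split; left; apply (tri_between d Hm Hcat); tauto.
Qed.
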